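(* Let $S$ be a set of $n$ points in $\mathbb{R}^3$, no three collinear and not all coplanar. For $k\geqslant 3$ let $m_k$ be the number of planes containing exactly $k$ points of $S$. Then \[ -3n \geqslant \sum_{k\geqslant3}k(k-4)m_k. \] *)

(* Defs.v *)
From mathcomp Require Import all_boot all_order all_algebra finmap.
From mathcomp Require Import all_classical all_reals.
Set Implicit Arguments.
Unset Strict Implicit.
Unset Printing Implicit Defensive.
Import Order.TTheory GRing.Theory Num.Theory.
Local Open Scope classical_set_scope.
Local Open Scope ring_scope.

(* A is p + V for some point p and some d-dimensional linear subspace V,
   where V is the row space of U. *)
Definition is_flat (F : fieldType) (N d : nat) (A : set 'rV[F]_N) : Prop :=
  exists (p : 'rV[F]_N) (U : 'M[F]_N),
    \rank U = d /\ A = [set x | (x - p <= U)%MS].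

Definition is_line (F : fieldType) (N : nat) (A : set 'rV[F]_N) : Prop :=
  is_flat 1 A.

Definition is_plane (F : fieldType) (N : nat) (A : set 'rV[F]_N) : Prop :=
  is_flat 2 A.

Definition collinear (F : fieldType) (N : nat) (A : set 'rV[F]_N) : Prop :=
  exists L, is_line L /\ A `<=` L.

Definition coplanar (F : fieldType) (N : nat) (A : set 'rV[F]_N) : Prop :=
  exists P, is_plane P /\ A `<=` P.

Definition planes_with (F : fieldType) (N : nat) (S : set 'rV[F]_N) (k : nat) :
    set (set 'rV[F]_N) :=
  [set P | is_plane P /\ (P `&` S #= `I_k)%card].

(* [fset_set] of an infinite set is empty, so this is the number of planes
   only when [planes_with S k] is finite.  It is for k >= 3 and S finite with
   no three points collinear, as such a plane is determined by any three of its
   points in S. *)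
Definition plane_count (F : fieldType) (N : nat) (S : set 'rV[F]_N) (k : nat) :
    nat :=
  #|` fset_set (planes_with S k)|.

(* Main.v *)
(* Projecting [S] from one of its points [p] gives n - 1 points of the projective
   plane, not all collinear, in which a plane through [p] with k points of [S]
   becomes a line with k - 1 points. Melchior's inequality, sum (j - 3) t_j <= -3
   for the numbers t_j of lines with exactly j points, bounds the sum of k - 4
   over the planes through [p] by -3, and summing over [p] counts each plane k
   times.

   Dually, Melchior's inequality is about lines y = a_i x + b_i with distinct
   slopes, not all concurrent, and reads sum (j - 1) t_j + 3 <= 2 sum t_j with
   t_j the number of vertices on exactly j lines. A vertex on j lines is the
   left end of j - 1 faces, and it is also neither the left nor the right end of
   two faces, the one above it and the one below it. Every face with a left end,
   continued through infinity if unbounded, has a vertex of this second kind, the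
   first one met from its left end; this is an injection that misses the vertices
   of the upper and lower envelopes, of which there are at least three. *)
Require Import Defs.
From mathcomp Require Import all_boot all_order all_algebra finmap.
From mathcomp Require Import all_classical all_reals.
From mathcomp Require Import ring zify.
Set Implicit Arguments.
Unset Strict Implicit.
Unset Printing Implicit Defensive.
Import Order.TTheory GRing.Theory Num.Theory.
Local Open Scope ring_scope.

(** * Melchior's inequality for lines in the affine plane *)

Section Melchior.
Variables (R : realFieldType) (I : finType) (a b : I -> R).
Hypothesis a_inj : injective a.

Definition height i x : R := a i * x + b i.
Definition cross i j : R := (b j - b i) / (a i - a j).

Lemma slope_neq i j : i != j -> a i - a j != 0.
Proof. by rewrite subr_eq0 (inj_eq a_inj). Qed.

Lemma crossC i j : cross i j = cross j i.
Proof. by rewrite /cross -[in RHS]opprB -[a j - a i]opprB invrN mulrNN. Qed.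

Lemma height_crossE i j x :
  i != j -> height j x - height i x = (a j - a i) * (x - cross i j).
Proof.
move=> /slope_neq ij; rewrite /height /cross.
by field.
Qed.

Lemma height_cross i j : i != j -> height j (cross i j) = height i (cross i j).
Proof.
by move=> ij; apply/eqP; rewrite -subr_eq0 height_crossE // subrr mulr0.
Qed.

Lemma height_eq i j x : i != j -> (height i x == height j x) = (x == cross i j).
Proof.
move=> ij; rewrite eq_sym -subr_eq0 height_crossE // mulf_eq0 subr_eq0.
by rewrite (inj_eq a_inj) eq_sym (negPf ij) subr_eq0.
Qed.

Lemma height_lt i j x : a i < a j -> (height i x < height j x) = (cross i j < x).
Proof.
move=> ij; rewrite -subr_gt0 height_crossE; first by rewrite pmulr_rgt0 ?subr_gt0.
by apply: contraTneq ij => ->; rewrite ltxx.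
Qed.

Lemma height_gt i j x : a i < a j -> (height j x < height i x) = (x < cross i j).
Proof.
move=> ij; rewrite -subr_lt0 height_crossE.
  by rewrite pmulr_rlt0 ?subr_gt0 // subr_lt0.
by apply: contraTneq ij => ->; rewrite ltxx.
Qed.

(** A vertex is encoded as the set of all lines through it, so [vertices] lists each point once and
    [#|B|] counts its lines. *)
Definition vertex i j := [set k | height k (cross i j) == height i (cross i j)].

Definition vertices := [set vertex p.1 p.2 | p : I * I & p.1 != p.2].

(** On [vertices] the choice of the pair does not matter; 0 is reached only by sets with fewer than
    two lines. *)
Definition abscissa (B : {set I}) : R :=
  if [pick p : I * I | [&& p.1 \in B, p.2 \in B & p.1 != p.2]] is Some p
  then cross p.1 p.2 else 0.

Lemma vertex_in i j : i != j -> vertex i j \in vertices.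
Proof. by move=> ij; apply/imsetP; exists (i, j); rewrite ?inE. Qed.

Lemma vertexl i j : i \in vertex i j.
Proof. by rewrite inE. Qed.

Lemma vertexr i j : i != j -> j \in vertex i j.
Proof. by move=> ij; rewrite inE height_cross. Qed.

Lemma vertexE B i j : B \in vertices -> i \in B -> j \in B -> i != j ->
  B = vertex i j.
Proof.
case/imsetP=> -[k l]; rewrite inE /= => kl ->; rewrite !inE => /eqP hi /eqP hj ij.
have E : cross i j = cross k l by apply/esym/eqP; rewrite -height_eq // hi hj.
by apply/setP=> m; rewrite !inE E hi.
Qed.

Lemma abscissa_vertex i j : i != j -> abscissa (vertex i j) = cross i j.
Proof.
move=> ij; rewrite /abscissa; case: pickP => [[k l] /=|/(_ (i, j))]; last first.
  by rewrite /= vertexl vertexr // ij.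
rewrite !inE => /and3P[/eqP hk /eqP hl kl].
by apply/esym/eqP; rewrite -height_eq // hk hl.
Qed.

Lemma abscissaE B i j : B \in vertices -> i \in B -> j \in B -> i != j ->
  abscissa B = cross i j.
Proof.
by move=> BV iB jB ij; rewrite (vertexE BV iB jB ij) abscissa_vertex.
Qed.

Lemma mem_vertex B i j : B \in vertices -> i \in B ->
  (j \in B) = (height j (abscissa B) == height i (abscissa B)).
Proof.
case/imsetP=> -[k l]; rewrite inE /= => kl ->; rewrite abscissa_vertex // !inE.
by move=> /eqP ->.
Qed.

Lemma vertex_inj B C i : B \in vertices -> C \in vertices ->
  i \in B -> i \in C -> abscissa B = abscissa C -> B = C.
Proof.
move=> BV CV iB iC E; apply/setP=> j.
by rewrite (mem_vertex _ BV iB) (mem_vertex _ CV iC) E.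
Qed.

Lemma vertex_height B i j : B \in vertices -> i \in B -> j \in B ->
  height i (abscissa B) = height j (abscissa B).
Proof. by move=> BV iB; rewrite (mem_vertex _ BV iB) => /eqP ->. Qed.

(* Near [w], just left of it, the steepest line of [w] is the lowest one and
   bounds the face below [w]; the least steep one bounds the face above. *)
Definition extreme (s : bool) l (w : {set I}) :=
  l \in w /\ forall k, k \in w -> k != l -> if s then a k < a l else a l < a k.

Definition consecutive i m (v : {set I}) :=
  [/\ i \in v, m \in v, a i < a m & forall k, k \in v -> a i < a k -> a m <= a k].

(* [w] follows [v] in the cyclic order of the vertices on the line [l]. *)
Definition follows (wrap : bool) l (v w : {set I}) :=
  [/\ l \in v, l \in w & if wrap
    then abscissa w < abscissa v /\
         forall u, u \in vertices -> l \in u -> abscissa w <= abscissa u <= abscissa v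
    else abscissa v < abscissa w /\
         forall u, u \in vertices -> l \in u -> abscissa v < abscissa u ->
           abscissa w <= abscissa u].

(* The face issued from [v] to the right, between its consecutive lines [i] and
   [m], has [w] as its next vertex, on its upper side if [s] and on its lower
   side otherwise. Passing through infinity exchanges above and below. *)
Definition charges (v : {set I}) i (w : {set I}) (s : bool) :=
  exists m (wrap : bool), let l := if s (+) wrap then m else i in
  [/\ consecutive i m v, follows wrap l v w & extreme s l w].

Lemma extreme_uniq s l l' w : extreme s l w -> extreme s l' w -> l = l'.
Proof.
move=> [lw lP] [lw' lP']; apply/eqP; apply: contraT => ll'.
have := lP _ lw'; have := lP' _ lw ll'; rewrite eq_sym ll' => h /(_ isT).
by case: (s) h => h1 h2; have := lt_trans h1 h2; rewrite ltxx.
Qed.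

(** The step to [w] wraps exactly when [w] is the leftmost vertex of [l]; the predecessor is then
    the rightmost one, and otherwise the nearest one left of [w]. *)
Lemma follows_uniq b1 b2 l v1 v2 w : v1 \in vertices -> v2 \in vertices ->
  w \in vertices ->
  follows b1 l v1 w -> follows b2 l v2 w -> b1 = b2 /\ v1 = v2.
Proof.
move=> V1 V2 W [l1 lw f1] [l2 _ f2].
have E : abscissa v1 = abscissa v2 -> v1 = v2 by apply: vertex_inj l1 l2.
case: b1 b2 f1 f2 => -[] [xw f1] [xw' f2].
- split=> //; apply: E; apply/le_anti.
  by have /andP[_ ->] := f2 _ V1 l1; have /andP[_ ->] := f1 _ V2 l2.
- by have /andP[] := f1 _ V2 l2; rewrite leNgt xw'.
- by have /andP[] := f2 _ V1 l1; rewrite leNgt xw.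
- split=> //; apply: E; apply/eqP; rewrite eq_le !leNgt.
  by apply/andP; split; apply/negP => h;
    [have := f2 _ V1 l1 h | have := f1 _ V2 l2 h]; rewrite leNgt (xw, xw').
Qed.

(** [w] and [s] determine [l], then [v] and the wrapping, hence whether [l] is the lower or the
    upper line of the pair; the other one is its neighbour at [v]. *)
Lemma charges_inj v i v' i' w s : v \in vertices -> v' \in vertices ->
  w \in vertices -> charges v i w s -> charges v' i' w s -> (v, i) = (v', i').
Proof.
move=> V V' W [m [c [[iv mv im adj] F E]]] [m' [c' [[iv' mv' im' adj'] F' E']]].
have ll := extreme_uniq E E'; rewrite -ll in F'.
have [cc vv] := follows_uniq V V' W F F'; subst c' v'.
congr pair; case: (s (+) c) ll => // mm; subst m'.
apply/a_inj/eqP; rewrite eq_le !leNgt; apply/andP; split; apply/negP => h.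
  by have := adj' _ iv h; rewrite leNgt im.
by have := adj _ iv' h; rewrite leNgt im'.
Qed.

Lemma slope_neq_lt i j : i != j -> a i < a j \/ a j < a i.
Proof. by rewrite -(inj_eq a_inj) => /lt_total /orP. Qed.

Lemma lt_slope_neq i j : a i < a j -> i != j.
Proof. by apply: contraTneq => ->; rewrite ltxx. Qed.

Hypothesis not_concurrent : forall B, B \in vertices -> exists k, k \notin B.

(** Take for [w] the first vertex right of [v] on [i] or [m] or, if there is none, the leftmost
    vertex on these two lines. A line violating [extreme] at [w] would meet one of the two earlier
    in this order. *)
Lemma charges_exists v i j : v \in vertices -> i \in v -> j \in v -> a i < a j ->
  exists w s, w \in vertices /\ charges v i w s.
Proof.
move=> V iv jv ij.
have [m] : exists m, consecutive i m v.
  have P0 : (j \in v) && (a i < a j) by rewrite jv.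
  case: (@arg_minP _ _ _ j (fun k => (k \in v) && (a i < a k)) a P0) => m.
  move=> /andP[mv im] mP; exists m; split=> // k kv ik.
  by apply: mP; rewrite kv.
move=> C; have [_ mv im adj] := C.
have hv : height i (abscissa v) = height m (abscissa v) by apply: vertex_height.
have xv : abscissa v = cross i m by apply: abscissaE => //; apply: lt_slope_neq.
pose P w := [&& w \in vertices, (i \in w) || (m \in w) & abscissa v < abscissa w].
have [w0 Pw0|none] := pickP P.
  case: (arg_minP abscissa Pw0) => w /and3P[W imw vw] wP.
  have wmin k l : (k == i) || (k == m) -> k != l ->
      abscissa v < cross k l -> abscissa w <= cross k l.
    move=> kim kl h; rewrite -abscissa_vertex // wP // /P vertex_in //.
    by rewrite abscissa_vertex // h; case/orP: kim => /eqP <-; rewrite vertexl ?orbT.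
  have fol l : (l == i) || (l == m) -> l \in w -> follows false l v w.
    move=> lim lw; split=> //; first by case/orP: lim => /eqP ->.
    split=> // u U lu vu; apply: wP; rewrite /P U vu andbT /=.
    by case/orP: lim => /eqP <-; rewrite lu ?orbT.
  have [mw|mw] := boolP (m \in w).
    exists w, true; split=> //; exists m, false; split=> //=.
      by apply: fol; rewrite ?eqxx ?orbT.
    split=> // k kw km; have [//|mk] := slope_neq_lt km.
    have xw : abscissa w = cross m k by apply: abscissaE; rewrite // eq_sym.
    have ik := lt_trans im mk.
    have h1 : abscissa v < cross i k.
      by rewrite -height_gt // hv height_gt // -xw.
    have h2 : cross i k < abscissa w.
      by rewrite -height_lt // (vertex_height W kw mw) height_lt // -xv.
    have := wmin i k; rewrite eqxx /= => /(_ isT (lt_slope_neq ik) h1).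
    by rewrite leNgt h2.
  have iw : i \in w by rewrite (negPf mw) orbF in imw.
  exists w, false; split=> //; exists m, false; split=> //=.
    by apply: fol; rewrite ?eqxx.
  split=> // k kw ki; have [ik|//] := slope_neq_lt ki.
  have xw : abscissa w = cross k i by apply: abscissaE.
  have km := lt_trans ik im.
  have h1 : abscissa v < cross k m.
    by rewrite -height_gt // -hv height_gt // -xw.
  have h2 : cross k m < abscissa w.
    by rewrite -height_lt // (vertex_height W kw iw) height_lt // -xv.
  have := wmin m k; rewrite eqxx orbT eq_sym (lt_slope_neq km) crossC.
  by move=> /(_ isT isT h1); rewrite leNgt h2.
have vmax k l : (k == i) || (k == m) -> k != l -> ~~ (abscissa v < cross k l).
  move=> kim kl; apply/negP => h; have := none (vertex k l).
  rewrite /P vertex_in // abscissa_vertex // h andbT /=.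
  by case/orP: kim => /eqP <-; rewrite vertexl ?orbT.
pose Q w := (w \in vertices) && ((i \in w) || (m \in w)).
have Qv : Q v by rewrite /Q V iv.
case: (arg_minP abscissa Qv) => w /andP[W imw] wP.
(* Some line misses [v]; it cannot cross [i] at [v] or to its right, so it does so on the left. *)
have wv : abscissa w < abscissa v.
  have [k kv] := not_concurrent V.
  have ik : i != k by apply: contraNneq kv => <-.
  have : abscissa w <= abscissa (vertex i k).
    by apply: wP; rewrite /Q vertex_in // vertexl.
  move=> /le_lt_trans; apply; rewrite lt_neqAle abscissa_vertex //.
  rewrite leNgt vmax ?eqxx // andbT; apply: contraNneq kv.
  rewrite -abscissa_vertex // => E.
  rewrite -(@vertex_inj (vertex i k) v i) ?vertexl ?vertexr //.
  exact: vertex_in.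
have wmin k l : (k == i) || (k == m) -> k != l -> abscissa w <= cross k l.
  move=> kim kl; rewrite -abscissa_vertex // wP // /Q vertex_in //=.
  by case/orP: kim => /eqP <-; rewrite vertexl ?orbT.
have fol l : (l == i) || (l == m) -> l \in w -> follows true l v w.
  move=> lim lw; split=> //; first by case/orP: lim => /eqP ->.
  split=> // u U lu; have imu : (i \in u) || (m \in u).
    by case/orP: lim => /eqP <-; rewrite lu ?orbT.
  by rewrite wP /Q ?U // leNgt; have := none u; rewrite /P U imu /= => ->.
(* A line of intermediate slope runs through [v], against the choice of [m], or below or above [v],
   and then crosses [i] or [m] to the right of [v]. *)
have between k : a i < a k -> a k < a m -> False.
  move=> ik km.
  have [hk|hk|/eqP hk] := ltgtP (height k (abscissa v)) (height i (abscissa v)).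
  - by move: hk; rewrite height_gt // (negPf (vmax i k _ _)) ?eqxx ?lt_slope_neq.
  - move: hk; rewrite hv height_gt // crossC (negPf (vmax m k _ _)) ?eqxx ?orbT //.
    by rewrite eq_sym lt_slope_neq.
  by have := adj k; rewrite (mem_vertex _ V iv) hk leNgt km => /(_ isT ik).
(* Left of [v] the line [i] is above [m], so a line violating [extreme] at [w] would cross the other
   of the two left of [w]. *)
have [iw|iw] := boolP (i \in w).
  exists w, true; split=> //; exists m, true; split=> //=.
    by apply: fol; rewrite ?eqxx.
  split=> // k kw ki; have [//|ik] := slope_neq_lt ki.
  have km : k != m.
    apply: contraTneq wv => km; rewrite xv (abscissaE W iw kw) ?km ?ltxx //.
    by rewrite -km eq_sym.
  have [km'|mk] := slope_neq_lt km; first by case: (between k).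
  have : cross m k < abscissa w.
    by rewrite -height_lt // (vertex_height W kw iw) height_gt // -xv.
  by rewrite ltNge wmin ?eqxx ?orbT // eq_sym.
have mw : m \in w by rewrite (negPf iw) in imw.
exists w, false; split=> //; exists m, true; split=> //=.
  by apply: fol; rewrite ?eqxx ?orbT.
split=> // k kw km; have [km'|//] := slope_neq_lt km.
have ki : k != i by apply: contraNneq iw => <-.
have [ki'|ik] := slope_neq_lt ki; last by case: (between k).
have : cross k i < abscissa w.
  by rewrite -height_lt // (vertex_height W kw mw) height_gt // -xv.
by rewrite ltNge crossC wmin ?eqxx // eq_sym.
Qed.

(** The lower envelope if [s] and the upper one otherwise, matching the face below or above [w] in
    [charges]. *)
Definition on_envelope (s : bool) (w : {set I}) := w \in vertices /\
  forall l k, l \in w -> if s then height l (abscissa w) <= height k (abscissa w)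
                        else height k (abscissa w) <= height l (abscissa w).

(** The other side of a charging face passes strictly below [w] if [s] and strictly above it
    otherwise, where the envelope leaves no line. *)
Lemma on_envelope_uncharged s v i w :
  v \in vertices -> on_envelope s w -> ~ charges v i w s.
Proof.
move=> V [W env] [m [c [[iv mv im _] [_ lw F] _]]].
have xv : abscissa v = cross i m by apply: abscissaE => //; apply: lt_slope_neq.
move: (env _ i lw) (env _ m lw) F; rewrite xv; case: (s) (c) => -[] /= h1 h2 [].
- by rewrite -height_gt // ltNge h2.
- by rewrite -height_lt // ltNge h1.
- by rewrite -height_gt // ltNge h1.
- by rewrite -height_lt // ltNge h2.
Qed.

Lemma on_envelope_line s (w : {set I}) (l : I) : w \in vertices -> l \in w ->
  (forall k, k != l -> if s then height l (abscissa w) <= height k (abscissa w)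
                       else height k (abscissa w) <= height l (abscissa w)) ->
  on_envelope s w.
Proof.
move=> W lw h; split=> // l' k l'w; rewrite -(vertex_height W lw l'w).
have [->|/h //] := eqVneq k l.
by case: (s).
Qed.

(* At infinity the extreme slopes bound the arrangement, so the first and last
   vertices of these two lines are on the envelopes; they could make up only
   two pairs [(s, w)] if all lines met at one point. *)
Lemma envelope_card (i j : I) : i != j ->
  exists2 E : {set {set I} * bool}, (3 <= #|E|)%N &
    forall t, t \in E -> on_envelope t.2 t.1.
Proof.
move=> ij.
have [L _ Lmin] := @arg_minP _ _ _ i predT a isT.
have [M _ Mmax] := @arg_maxP _ _ _ i predT a isT.
have LM : a L < a M.
  by have [h|h] := slope_neq_lt ij;
    exact: le_lt_trans (Lmin _ isT) (lt_le_trans h (Mmax _ isT)).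
have Llt (k : I) : k != L -> a L < a k.
  by move=> kL; rewrite lt_neqAle Lmin // (inj_eq a_inj) eq_sym kL.
have Mgt (k : I) : k != M -> a k < a M.
  by move=> kM; rewrite lt_neqAle [a k <= _]Mmax // (inj_eq a_inj) kM.
have LM' := lt_slope_neq LM.
pose on l := [pred w : {set I} | (w \in vertices) && (l \in w)].
have onL : on L (vertex L M) by rewrite /= vertex_in // vertexl.
have onM : on M (vertex L M) by rewrite /= vertex_in // vertexr.
have onV (l k : I) : k != l -> on l (vertex l k).
  by move=> kl; rewrite /= vertex_in ?vertexl // eq_sym.
have [f1 /andP[V1 L1] m1] := arg_minP abscissa onL.
have [f2 /andP[V2 L2] m2] := arg_maxP abscissa onL.
have [f3 /andP[V3 M3] m3] := arg_minP abscissa onM.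
have [f4 /andP[V4 M4] m4] := arg_maxP abscissa onM.
(* Left of its first vertex [L] is the top line, right of its last one the bottom line; for [M] it
   is the other way round. *)
have E1 : on_envelope false f1.
  apply: (on_envelope_line V1 L1) => k kL; rewrite leNgt height_lt ?Llt // -leNgt.
  by rewrite -abscissa_vertex ?m1 ?onV // eq_sym.
have E2 : on_envelope true f2.
  apply: (on_envelope_line V2 L2) => k kL; rewrite leNgt height_gt ?Llt // -leNgt.
  by rewrite -abscissa_vertex ?[_ <= _]m2 ?onV // eq_sym.
have E3 : on_envelope true f3.
  apply: (on_envelope_line V3 M3) => k kL; rewrite leNgt height_lt ?Mgt // -leNgt.
  by rewrite crossC -abscissa_vertex ?m3 ?onV // eq_sym.
have E4 : on_envelope false f4.
  apply: (on_envelope_line V4 M4) => k kL; rewrite leNgt height_gt ?Mgt // -leNgt.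
  by rewrite crossC -abscissa_vertex ?[_ <= _]m4 ?onV // eq_sym.
have [f14|f14] := eqVneq f1 f4; last first.
  exists [set (f1, false); (f4, false); (f2, true)].
    rewrite -finset.setUA !cardsU1 !inE cards1 !xpair_eqE /=.
    by rewrite !andbF orbF andbT (negPf f14).
  by move=> t; rewrite !inE => /orP[/orP[]|] /eqP ->.
have [f23|f23] := eqVneq f2 f3; last first.
  exists [set (f2, true); (f3, true); (f1, false)].
    rewrite -finset.setUA !cardsU1 !inE cards1 !xpair_eqE /=.
    by rewrite !andbF orbF andbT (negPf f23).
  by move=> t; rewrite !inE => /orP[/orP[]|] /eqP ->.
have F1 : f1 = vertex L M by apply: vertexE; rewrite ?f14 // -f14.
have F2 : f2 = vertex L M by apply: vertexE; rewrite ?f23 // -f23.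
have [k] := not_concurrent V1; rewrite F1 => kLM.
have Lk : k != L by apply: contraNneq kLM => ->; rewrite vertexl.
case/negP: kLM; suff <- : vertex L k = vertex L M by rewrite vertexr // eq_sym.
have [kV kL] := andP (onV _ _ Lk).
rewrite -F1; apply: (vertex_inj kV V1 kL L1).
by apply/le_anti; rewrite m1 ?onV // andbT F1 -F2 [_ <= _]m2 ?onV.
Qed.

(** Each of these lines is the lower side of exactly one face with left end [B]. *)
Definition nonsteepest (B : {set I}) :=
  [set k in B | [exists j in B, a k < a j]].

Lemma card_nonsteepest (B : {set I}) i : i \in B ->
  #|nonsteepest B| = #|B|.-1.
Proof.
move=> iB.
have [M /= MB Mmax] : exists2 M, M \in B &
    forall k, k \in B -> a k <= a M.
  by case: (arg_maxP a iB) => M; exists M.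
rewrite (cardsD1 M B) MB /=; apply: eq_card => k; rewrite !inE.
have [-> /=|kM /=] := eqVneq k M.
  apply/negP => /andP[_ /existsP[j /andP[jB]]]; rewrite ltNge.
  by rewrite Mmax.
case kB: (k \in B) => //=; apply/existsP; exists M; rewrite MB lt_neqAle.
by rewrite (inj_eq a_inj) kM Mmax.
Qed.

Lemma melchior (i j : I) : i != j ->
  \sum_(B in vertices) (#|B|%:Z - 3) <= - 3.
Proof.
move=> ij; have [E E3 Eenv] := envelope_card ij.
(* [W] lists the faces with a left end, by that vertex and the lower side; [T] holds the two places,
   below and above, at each vertex. *)
pose W := [set p : {set I} * I | (p.1 \in vertices) && (p.2 \in nonsteepest p.1)].
pose T := finset.setX vertices [set: bool].
have EV : E \subset T.
  by apply/fintype.subsetP=> t /Eenv[]; rewrite !inE => ->.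
have /choice[g gP] : forall p, exists t : {set I} * bool, p \in W ->
    t.1 \in vertices /\ charges p.1 p.2 t.1 t.2.
  move=> [v k].
  have [|] := boolP ((v, k) \in W); last by exists (v, true).
  rewrite !inE /= => /and3P[V kv /existsP[l /andP[lv kl]]].
  by have [w [s h]] := charges_exists V kv lv kl; exists (w, s).
have gW : {in W &, injective g}.
  move=> [v k] [v' k'] vW vW' E'.
  have [w c] := gP _ vW; have [w' c'] := gP _ vW'; rewrite -E' in c'.
  have [V V'] : v \in vertices /\ v' \in vertices.
    by move: vW vW'; rewrite !inE => /andP[-> _] /andP[-> _].
  exact: charges_inj c c'.
have WT : (#|W| + 3 <= #|T|)%N.
  rewrite -(card_in_imset gW) -(cardsID E T) (finset.setIidPr EV) addnC leq_add //.
  apply/subset_leq_card/fintype.subsetP=> _ /imsetP[p pW ->].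
  have [w c] := gP _ pW; rewrite !inE w !andbT; apply/negP => /Eenv h.
  have V : p.1 \in vertices by move: pW; rewrite !inE => /andP[].
  exact: on_envelope_uncharged V h c.
have cW : #|W| = (\sum_(B in vertices) #|B|.-1)%N.
  transitivity (\sum_(B in vertices) \sum_(k in nonsteepest B) 1)%N.
    by rewrite pair_big_dep /= -sum1_card; apply: eq_bigl => p; rewrite [LHS]inE.
  apply: eq_bigr => B BV; rewrite sum1_card.
  have [[k l] _ E'] := imsetP BV.
  by apply: (@card_nonsteepest _ k); rewrite E' vertexl.
have E' : \sum_(B in vertices) (#|B|%:Z - 3) =
    \sum_(B in vertices) (#|B|.-1)%:Z - \sum_(B in vertices) 2.
  rewrite -sumrB; apply: eq_bigr => B BV.
  have [[k l] _ E'] := imsetP BV.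
  by have : (0 < #|B|)%N; [apply/card_gt0P; exists k; rewrite E' vertexl | lia].
rewrite E' sumr_const -(big_morph Posz PoszD (erefl _)).
have := WT; rewrite cW cardsX cardsT card_bool; lia.
Qed.
End Melchior.

(** * Melchior's inequality in terms of vectors *)

Lemma poly_eq0_on_uniq (R : idomainType) (p : {poly R}) (s : seq R) :
  uniq s -> (size p <= size s)%N -> all (root p) s -> p = 0.
Proof.
move=> us sp ps; apply/eqP; apply: contraTT sp => p0.
by rewrite -ltnNge max_poly_roots // uniq_rootsE.
Qed.

Lemma exists_nonroot (R : numDomainType) (p : {poly R}) :
  p != 0 -> exists x, p.[x] != 0.
Proof.
move=> p0; apply: contrapT => /forallNP h.
have /eqP := p0; apply; pose s := [seq n%:R : R | n <- iota 0 (size p)].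
apply: (@poly_eq0_on_uniq _ _ s).
- by rewrite map_inj_uniq ?iota_uniq // => m n /eqP; rewrite eqr_nat => /eqP.
- by rewrite size_map size_iota.
by apply/allP => x _; apply/rootP/eqP/negPn/negP/h.
Qed.

(** For pairwise independent vectors, these are the projective lines through two of the points, each
    given by all the points on it. *)
Definition spanned_sets (F : fieldType) (I : finType) m (v : I -> 'rV[F]_m) :=
  [set [set k | (v k <= v p.1 + v p.2)%MS] | p : I * I & p.1 != p.2].

Lemma sub_add_rVP (F : fieldType) m (u v w : 'rV[F]_m) :
  reflect (exists c d, u = c *: v + d *: w) (u <= v + w)%MS.
Proof.
apply: (iffP sub_addsmxP) => [[[c d] /= ->]|[c [d ->]]].
  by exists (c 0 0), (d 0 0); rewrite -!mul_scalar_mx -!mx11_scalar.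
by exists (c%:M, d%:M); rewrite /= !mul_scalar_mx.
Qed.

(* The functionals [v |-> (rVpoly v).[x]] are in general position: a nonzero
   vector is killed by fewer than three of them. Three of them serve as
   homogeneous coordinates [1 : a : b] in which no point of the configuration
   is at infinity and no two points have the same [a]. *)
Lemma exists_chart (R : realFieldType) (I : finType) (v : I -> 'rV[R]_3) :
  (forall i j, i != j -> ~~ (v i <= v j)%MS) -> (forall i, v i != 0) ->
  exists a b : I -> R, injective a /\ vertices a b = spanned_sets v.
Proof.
move=> indep v0; pose p i := rVpoly (v i).
have rVpoly_eq0 (u : 'rV[R]_3) : rVpoly u = 0 -> u = 0.
  by move=> h; rewrite -[u]rVpolyK h linear0.
have [t pt] : exists t, forall i, (p i).[t] != 0.
  have /exists_nonroot[t] : \prod_i p i != 0.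
    by apply/prodf_neq0 => i _; apply: contra_neq (v0 i) => /rVpoly_eq0.
  by rewrite horner_prod => /prodf_neq0 h; exists t => i; apply: h.
have [s [st ps]] : exists s, s != t /\ forall i j, i != j ->
    (p i).[s] * (p j).[t] - (p j).[s] * (p i).[t] != 0.
  (* The first factor keeps [s] apart from [t]; the others make the ratios [a i] distinct. *)
  pose q := ('X - t%:P) * \prod_(ij : I * I | ij.1 != ij.2)
    (p ij.1 * (p ij.2).[t]%:P - p ij.2 * (p ij.1).[t]%:P).
  have /exists_nonroot[s] : q != 0.
    rewrite mulf_neq0 ?polyXsubC_eq0 //; apply/prodf_neq0 => -[i j] /= ij.
    apply: contra (indep _ _ ij) => /eqP.
    rewrite ![_ * _%:P]mulrC !mul_polyC -!linearZ -linearB /= => /rVpoly_eq0.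
    move=> /eqP; rewrite subr_eq0 => /eqP E.
    by rewrite -[v i](scalerK (pt j)) E !scalemx_sub.
  rewrite hornerM mulf_eq0 negb_or !hornerE subr_eq0 => /andP[st].
  rewrite horner_prod => /prodf_neq0 h; exists s; split=> // i j ij.
  by have := h (i, j) ij; rewrite !hornerE.
have [r rts] : exists r, (r != t) && (r != s).
  have /exists_nonroot[r] : ('X - t%:P) * ('X - s%:P) != 0.
    by rewrite mulf_neq0 ?polyXsubC_eq0.
  by rewrite !hornerE mulf_eq0 negb_or !subr_eq0; exists r.
have eq_rV (u w : 'rV[R]_3) : (forall x, x \in [:: t; s; r] ->
    (rVpoly u).[x] = (rVpoly w).[x]) -> u = w.
  move=> h; apply/eqP; rewrite -subr_eq0; apply/eqP/rVpoly_eq0.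
  apply: (@poly_eq0_on_uniq _ _ [:: t; s; r]).
  - by rewrite /= !inE andbT negb_or eq_sym st ![_ == r]eq_sym rts.
  - exact: size_poly.
  apply/allP => x xs; rewrite /root linearB /= hornerD hornerN h //.
  by rewrite subrr.
pose a i := (p i).[s] / (p i).[t]; pose b i := (p i).[r] / (p i).[t].
have a_inj : injective a.
  move=> i j /eqP; rewrite eqr_div // => E; apply/eqP; apply: contraTT E => ij.
  by rewrite -subr_eq0 ps.
have pE i : (p i).[s] = a i * (p i).[t] /\ (p i).[r] = b i * (p i).[t].
  by rewrite /a /b !divfK.
exists a, b; split=> //; apply: eq_in_imset => -[i j]; rewrite inE /= => ij.
have aij := slope_neq a_inj ij.
apply/setP=> k; rewrite !inE; apply/idP/sub_add_rVP => [/eqP hk|[c [d vk]]].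
  have hj := height_cross b a_inj ij; set x := cross a b i j in hk hj.
  (* On lines through one common point, [b] is affine in [a], so the weights that interpolate [a k]
     between [a i] and [a j] also give [b k]. *)
  exists ((p k).[t] / (p i).[t] * ((a k - a j) / (a i - a j))).
  exists ((p k).[t] / (p j).[t] * ((a i - a k) / (a i - a j))).
  apply: eq_rV => y; rewrite linearD !linearZ /= hornerD !hornerZ.
  rewrite -/(p k) -/(p i) -/(p j).
  rewrite !inE => /or3P[] /eqP ->.
  - by field; rewrite !pt aij.
  - by rewrite !(pE _).1; field; rewrite !pt aij.
  have bE l : height a b l x = height a b i x -> b l = height a b i x - a l * x.
    by move=> <-; rewrite /height addrC addKr.
  rewrite !(pE _).2 (bE k) // (bE j) // (bE i) //.
  by field; rewrite !pt aij.
have hj := height_cross b a_inj ij; set x := cross a b i j in hj *.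
have pk y : (p k).[y] = c * (p i).[y] + d * (p j).[y].
  by rewrite /p vk linearD !linearZ /= hornerD !hornerZ.
(* Scaled by [(p k).[t]], the equation is linear in [v k], so it follows from those for [i] and
   [j]. *)
apply/eqP/(mulIf (pt k)); rewrite [in RHS]pk mulrDr.
have -> : height a b i x * (d * (p j).[t]) = height a b j x * (d * (p j).[t]).
  by rewrite hj.
rewrite /height !mulrDl mulrAC -(pE k).1 -(pE k).2 !pk !(pE _).1 !(pE _).2.
by ring.
Qed.

(** Projectively, the points are distinct and not all on one line; dually, the lines of the chart
    are not all concurrent. *)
Lemma melchior_rV (R : realFieldType) (I : finType) (v : I -> 'rV[R]_3) (i j : I) :
  i != j -> (forall i j, i != j -> ~~ (v i <= v j)%MS) ->
  (forall i j, exists k, ~~ (v k <= v i + v j)%MS) ->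
  \sum_(B in spanned_sets v) (#|B|%:Z - 3) <= - 3.
Proof.
move=> ij indep span3; have v0 k : v k != 0.
  have [l kl] : exists l, k != l.
    by have [->|] := eqVneq k i; [exists j | exists i].
  by apply: contraNneq (indep _ _ kl) => ->; rewrite sub0mx.
have [a [b [a_inj E]]] := exists_chart indep v0; rewrite -E.
apply: melchior ij => // B; rewrite E => /imsetP[[k l] _ ->].
by have [m hm] := span3 k l; exists m; rewrite inE.
Qed.

(** * Planes through the points of a configuration *)

Lemma card_eq_finset (T : finType) (X : {set T}) : ([set` X] #= `I_#|X|)%card.
Proof.
have -> : [set` X]%classic = [set` [fset x in X]%fset]%classic.
  by apply/seteqP; split=> x; rewrite /= !inE.
by apply/card_eq_fsetP; rewrite card_imfset //= cardE.
Qed.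

(** The first [d] rows of [row_ebase A] span such a space, as the first [\rank A] of them already
    span the rows of [A]. *)
Lemma exists_supspace (F : fieldType) m n d (A : 'M[F]_(m, n)) :
  (\rank A <= d <= n)%N -> exists U : 'M[F]_n, \rank U = d /\ (A <= U)%MS.
Proof.
case/andP=> Ad dn; exists (pid_mx d *m row_ebase A); split.
  by rewrite mxrankMfree ?row_free_unit ?row_ebase_unit // rank_pid_mx.
rewrite -{1}[A]mulmx_ebase.
have -> : pid_mx (\rank A) =
    (pid_mx (\rank A) : 'M_(m, n)) *m (pid_mx d : 'M[F]_n).
  by rewrite mul_pid_mx (minn_idPl Ad) (minn_idPr (rank_leq_col A)).
by rewrite mulmxA -mulmxA submxMl.
Qed.

Lemma rank_add_rV_le2 (F : fieldType) m (u v : 'rV[F]_m) : (\rank (u + v)%MS <= 2)%N.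
Proof.
have [le _] := mxrank_adds_leqif u v; apply: leq_trans le _.
by rewrite (leq_add (rank_leq_row _) (rank_leq_row _)).
Qed.

Section Planes.
Variables (F : fieldType) (N : nat).
Implicit Types (x y z w : 'rV[F]_N).

Definition span3 x y z : set 'rV[F]_N :=
  [set w | (w - x <= (y - x)%R + (z - x)%R)%MS]%classic.

(** A smaller rank would be 1, since [y - x] is nonzero, and [span3 x y z] would be a line through
    the three points. *)
Lemma rank_noncollinear x y z : x <> y -> ~ collinear [set x; y; z]%classic ->
  \rank ((y - x)%R + (z - x)%R)%MS = 2.
Proof.
move=> xy nc; apply/eqP; rewrite eqn_leq rank_add_rV_le2 /= ltnNge.
apply/negP => le1; apply: nc; exists (span3 x y z); split.
  exists x, ((y - x)%R + (z - x)%R)%MS; split=> //.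
  apply/eqP; rewrite eqn_leq le1 lt0n mxrank_eq0; apply/negP => /eqP E.
  have : (y - x <= (y - x)%R + (z - x)%R)%MS by apply: addsmxSl.
  by rewrite E submx0 subr_eq0 => /eqP /esym.
move=> w [[->|->]|->]; rewrite /span3 /=.
- by rewrite subrr sub0mx.
- exact: addsmxSl.
- exact: addsmxSr.
Qed.

Lemma plane_span3 x y z : \rank ((y - x)%R + (z - x)%R)%MS = 2 ->
  is_plane (span3 x y z).
Proof. by move=> r2; exists x, ((y - x)%R + (z - x)%R)%MS. Qed.

Lemma plane_eq_span3 P x y z : is_plane P -> P x -> P y -> P z ->
  \rank ((y - x)%R + (z - x)%R)%MS = 2 -> P = span3 x y z.
Proof.
move=> [p [U [rU ->]]] /= px py pz r2.
have sub a c : (a - p <= U)%MS -> (c - p <= U)%MS -> (a - c <= U)%MS.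
  by move=> h h'; rewrite -[a - c](subrKA p) -[p - c]opprB addmx_sub ?eqmx_opp.
have leU : ((y - x)%R + (z - x)%R <= U)%MS.
  by rewrite addsmx_sub (sub _ _ py px) (sub _ _ pz px).
have [_] := mxrank_leqif_sup leU; rewrite r2 rU eqxx => /esym Ule.
apply/seteqP; split=> w; rewrite /span3 /=.
  by move=> h; apply: submx_trans Ule; apply: sub.
by move=> /submx_trans /(_ leU) h; rewrite -[w - p](subrKA x) addmx_sub.
Qed.

End Planes.

(** * Projection from a point of the configuration *)

Section Configuration.
Variables (R : realFieldType) (n : nat) (q : 'I_n -> 'rV[R]_3).
Hypothesis rank_triple : forall i j k, i != j -> i != k -> j != k ->
  \rank ((q j - q i)%R + (q k - q i)%R)%MS = 2.
Hypothesis not_coplanar : forall i (U : 'M_3), \rank U = 2 ->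
  exists k, ~~ (q k - q i <= U)%MS.

Definition trace (P : set 'rV[R]_3) : {set 'I_n} := [set i | `[< P (q i) >]].

(** A finite stand-in for the planes with at least three points, faithful by [trace_inj]. *)
Definition plane_traces : {set {set 'I_n}} :=
  [set T : {set 'I_n} | (2 < #|T|)%N & `[< exists2 P, is_plane P & T = trace P >]].

Lemma trace_inj P P' : is_plane P -> is_plane P' -> (2 < #|trace P|)%N ->
  trace P = trace P' -> P = P'.
Proof.
move=> pP pP' /card_gt2P[i [j [k [[iT jT kT] [ij jk ki]]]]] E.
have r2 := rank_triple ij _ jk; rewrite eq_sym ki in r2.
have := (iT, jT, kT); rewrite E !inE => -[[iP' jP'] kP'].
move: iT jT kT; rewrite !inE => iP jP kP.
rewrite (plane_eq_span3 pP iP jP kP (r2 isT)).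
by rewrite (plane_eq_span3 pP' iP' jP' kP' (r2 isT)).
Qed.

Variable p : 'I_n.
Let I := {i : 'I_n | i != p}.
Let v (i : I) := q (val i) - q p.
(** Takes a line of the projected configuration to the trace of the plane through [q p] above it. *)
Let lift (B : {set I}) : {set 'I_n} := p |: [set val i | i in B].

Lemma mem_lift B (i : I) : (val i \in lift B) = (i \in B).
Proof. by rewrite !inE (negPf (valP i)) (mem_imset _ _ val_inj). Qed.

(** A plane through [q p] and two further points [q i], [q j] contains [q k] exactly when [v k] lies
    in the span of [v i] and [v j]. *)
Lemma plane_traces_lift :
  [set T in plane_traces | p \in T] = [set lift B | B in spanned_sets v].
Proof.
have rank_v i j : i != j -> \rank (v i + v j)%MS = 2.
  move=> ij; apply: rank_triple; rewrite ?(inj_eq val_inj) //.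
    by rewrite eq_sym (valP i).
  by rewrite eq_sym (valP j).
have trE i j : i != j -> trace (span3 (q p) (q (val i)) (q (val j))) =
    lift [set k | (v k <= v i + v j)%MS].
  move=> ij; apply/setP=> k; have [->|kp] := eqVneq k p.
    rewrite setU11 inE; apply/asboolP; rewrite /span3 /= subrr; exact: sub0mx.
  by rewrite -[k]/(val (Sub k kp : I)) mem_lift !inE; apply/asboolP/idP.
apply/setP=> T; rewrite !inE; apply/idP/imsetP.
  move=> /andP[/andP[T2 /asboolW[P pP E]] pT].
  have [i [j [iT jT ij]]] : exists i j : I, [/\ val i \in T, val j \in T & i != j].
    have /card_gt1P[i [j []]] : (1 < #|T :\ p|)%N.
      by move: T2; rewrite (cardsD1 p T) pT.
    rewrite !inE => /andP[ip iT] /andP[jp jT] ij.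
    by exists (Sub i ip), (Sub j jp); split.
  exists [set k | (v k <= v i + v j)%MS].
    by apply/imsetP; exists (i, j); rewrite ?inE.
  rewrite -trE // E; congr trace; move: iT jT pT; rewrite E !inE.
  move=> iP jP pP'.
  exact: plane_eq_span3 (rank_v _ _ ij).
move=> [B /imsetP[[i j]]]; rewrite inE /= => ij -> ->.
rewrite -trE //=; apply/andP; split; first (apply/andP; split).
- apply/card_gt2P; exists p, (val i), (val j); rewrite (inj_eq val_inj) ij.
  rewrite eq_sym !(valP i) (valP j) trE // !mem_lift setU11 !inE.
  by rewrite addsmxSl addsmxSr.
- apply/asboolP; exists (span3 (q p) (q (val i)) (q (val j))) => //.
  exact/plane_span3/rank_v.
by rewrite inE; apply/asboolP; rewrite /span3 /= subrr; exact: sub0mx.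
Qed.

(** Melchior's inequality for the projection from [q p]; [lift] adds the point [p], which turns 3
    into 4. *)
Lemma sum_plane_traces_at :
  \sum_(T in plane_traces | p \in T) (#|T|%:Z - 4) <= - 3.
Proof.
have lift_inj : injective lift.
  by move=> B C E; apply/setP=> i; rewrite -!mem_lift E.
have -> : \sum_(T in plane_traces | p \in T) (#|T|%:Z - 4) =
    \sum_(B in spanned_sets v) (#|B|%:Z - 3).
  transitivity (\sum_(T in [set T in plane_traces | p \in T]) (#|T|%:Z - 4)).
    by apply: eq_bigl => T; rewrite [RHS]finset.in_set.
  rewrite plane_traces_lift big_imset /=; last by move=> ? ? _ _; apply: lift_inj.
  apply: eq_bigr => B _; rewrite cardsU1 (card_imset _ val_inj).
  have -> : p \notin [set val i | i in B].
    by apply/imsetP => -[i _ /eqP]; apply/negP; rewrite eq_sym (valP i).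
  by rewrite PoszD -[4]/(1 + 3) opprD addrACA subrr add0r.
have span2 (u w : 'rV[R]_3) : exists k, ~~ (v k <= u + w)%MS.
  have uw2 : (\rank (u + w)%MS <= 2 <= 3)%N by rewrite rank_add_rV_le2.
  have [U [rU le]] := exists_supspace uw2.
  have [k kU] := not_coplanar p rU.
  have kp : k != p by apply: contraNneq kU => ->; rewrite subrr sub0mx.
  by exists (Sub k kp); apply: contra kU => h; apply: submx_trans le.
(* Degenerate spans yield two distinct points of the projection. *)
have [i] := span2 0 0; have [j] := span2 (v i) 0 => jP _.
have ij : i != j by apply: contraNneq jP => <-; exact: addsmxSl.
suff indep k l : k != l -> ~~ (v k <= v l)%MS.
  exact (melchior_rV ij indep (fun k l => span2 (v k) (v l))).
move=> kl; apply/negP => le.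
have := @rank_triple p (val k) (val l).
rewrite (inj_eq val_inj) kl ![p == _]eq_sym (valP k) (valP l) => /(_ isT isT isT).
have [_] := mxrank_leqif_sup (addsmxSr (v k) (v l)).
rewrite addsmx_sub le submx_refl /= => /eqP <- r1.
by have := rank_leq_row (v l); rewrite r1.
Qed.
End Configuration.

(** * Double counting of points and planes *)

Section Counting.
Variables (R : realFieldType) (n : nat) (q : 'I_n -> 'rV[R]_3).
Hypothesis rank_triple : forall i j k, i != j -> i != k -> j != k ->
  \rank ((q j - q i)%R + (q k - q i)%R)%MS = 2.
Hypothesis not_coplanar : forall i (U : 'M_3), \rank U = 2 ->
  exists k, ~~ (q k - q i <= U)%MS.

(** Summed over all [p], the local inequality counts [T] once for each of its [#|T|] points. *)
Lemma sum_plane_traces :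
  \sum_(T in plane_traces q) (#|T|%:Z * (#|T|%:Z - 4)) <= - 3 * n%:Z.
Proof.
have -> : \sum_(T in plane_traces q) (#|T|%:Z * (#|T|%:Z - 4)) =
    \sum_(p < n) \sum_(T in plane_traces q | p \in T) (#|T|%:Z - 4).
  rewrite (exchange_big_dep (mem (plane_traces q))) /=; last by move=> ? ? _ /andP[].
  apply: eq_bigr => T TP; rewrite (eq_bigl (fun p => p \in T)) => [|p].
    by rewrite sumr_const -[RHS]mulr_natl natz.
  by rewrite (TP : T \in plane_traces q).
have -> : - 3 * n%:Z = \sum_(p < n) - 3.
  by rewrite sumr_const card_ord -[RHS]mulr_natr (natz n).
apply: ler_sum => p _.
exact (sum_plane_traces_at rank_triple not_coplanar p).
Qed.

Hypothesis q_inj : injective q.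

Lemma card_eq_trace P : (P `&` range q #= `I_#|trace q P|)%card.
Proof.
have -> : (P `&` range q = q @` [set` trace q P])%classic.
  apply/seteqP; split=> [x [Px [i _ qi]]|_ [i /= iP <-]].
    by exists i; rewrite /= ?inE qi.
  by split; [move: iP; rewrite inE => /asboolP | exists i].
apply: (card_eq_trans _ (card_eq_finset _)).
by apply: inj_card_eq => ? ? _ _; apply: q_inj.
Qed.

Lemma planes_withP k P :
  planes_with (range q) k P <-> is_plane P /\ #|trace q P| = k.
Proof.
split=> [] [pP].
  move=> h; split=> //; apply/card_eq_II; apply: card_eq_trans h.
  by rewrite card_eq_sym card_eq_trace.
by move=> <-; split=> //; apply: card_eq_trace.
Qed.

(** For [k > 2] a plane with exactly [k] points is determined by its trace. *)
Lemma plane_countE k : (2 < k)%N ->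
  plane_count (range q) k = #|[set T in plane_traces q | #|T| == k]|.
Proof.
move=> k2; apply: card_fset_set; apply: card_eq_trans (card_eq_finset _).
have -> : [set` [set T in plane_traces q | #|T| == k]]%classic =
    [set trace q P | P in planes_with (range q) k]%classic.
  apply/seteqP; split=> [T|_ [P /planes_withP[pP kP] <-]] /=.
    rewrite !finset.in_set => /andP[/andP[_ /asboolP[P pP ->]] /eqP kP].
    by exists P => //; apply/planes_withP.
  rewrite !finset.in_set kP k2 eqxx andbT.
  by apply/asboolP; exists P.
rewrite card_eq_sym; apply: inj_card_eq => P P'.
rewrite !inE => /planes_withP[pP kP] /planes_withP[pP' _].
by apply: (trace_inj rank_triple) => //; rewrite kP.
Qed.

(** The traces are grouped by size, which lies between 3 and [n]; this is the range
    [iota 3 (n - 2)]. *)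
Lemma sum_plane_count :
  \sum_(k \in [set k : nat | (3 <= k)%N]%classic)
     (k%:Z * (k%:Z - 4) * (plane_count (range q) k)%:Z) =
  \sum_(T in plane_traces q) (#|T|%:Z * (#|T|%:Z - 4)).
Proof.
have PL k : (2 < k)%N -> k%:Z * (k%:Z - 4) * (plane_count (range q) k)%:Z =
    \sum_(T in plane_traces q | #|T| == k) (#|T|%:Z * (#|T|%:Z - 4)).
  move=> k2; rewrite plane_countE // -sum1_card.
  rewrite (big_morph Posz PoszD (erefl _)) mulr_sumr.
  apply: eq_big => T; rewrite finset.in_set // => /andP[_ /eqP ->].
  by rewrite mulr1.
rewrite (@fsbigE _ _ _ _ _ (iota 3 (n - 2))) ?iota_uniq //=; last 2 first.
- by move=> k; rewrite /= mem_iota => /andP[].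
- move=> k /= k2 kn; rewrite PL // big_pred0 // => T.
  apply/negP => /andP[_ /eqP E]; move: kn; rewrite mem_iota k2 /= => /negP; apply.
  have : (#|T| <= n)%N by rewrite -[X in (_ <= X)%N]card_ord max_card.
  by rewrite E; lia.
rewrite big_seq_cond (eq_bigr (fun k => \sum_(T in plane_traces q | #|T| == k)
  (#|T|%:Z * (#|T|%:Z - 4)))); last first.
  by move=> k /andP[]; rewrite mem_iota => /andP[k2 _] _; apply: PL.
rewrite (exchange_big_dep (mem (plane_traces q))) /=; last by move=> ? ? _ /andP[].
apply: eq_bigr => T TP.
rewrite -big_filter.
have T3 : #|T| \in iota 3 (n - 2).
  have := TP; rewrite finset.in_set mem_iota => /andP[T2 _].
  have TN : (#|T| <= n)%N by rewrite -[X in (_ <= X)%N]card_ord max_card.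
  by move: T2 TN; set t := #|T|; lia.
rewrite (_ : [seq k <- _ | _] = [:: #|T|]) ?big_seq1 //.
rewrite -[RHS](filter_pred1_uniq (iota_uniq 3 (n - 2)) T3).
apply: eq_in_filter => k kr; rewrite kr (TP : T \in plane_traces q) mem_set /=.
  by rewrite eq_sym.
by move: kr; rewrite mem_iota => /andP[].
Qed.
End Counting.

Local Open Scope classical_set_scope.

(* The sum ranges over all k >= 3; its support is finite, since
   [plane_count S k] is 0 for k > n. *)
Theorem theorem2 (R : realType) (n : nat) (S : set 'rV[R]_3)
  (cardS : (S #= `I_n)%card)
  (no3collinear : forall x y z : 'rV[R]_3, S x -> S y -> S z ->
     x <> y -> x <> z -> y <> z -> ~ collinear [set x; y; z])
  (not_coplanar : ~ coplanar S) :
  - 3 * n%:Z >=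
    \sum_(k \in [set k : nat | (3 <= k)%N])
       (k%:Z * (k%:Z - 4) * (plane_count S k)%:Z).
Proof.
have [q [q_inj SE]] : exists q : 'I_n -> 'rV[R]_3, injective q /\ S = range q.
  have finS : finite_set S by apply/finite_setP; exists n.
  have sizeS := card_fset_set cardS.
  (* The default 0 is never reached, as the list has length [n]. *)
  exists (fun i => nth 0 (fset_set S) i); split=> [i j /eqP|].
    by rewrite nth_uniq ?sizeS ?ltn_ord ?fset_uniq // => /eqP/val_inj.
  apply/seteqP; split=> [x Sx|_ [i _ <-]]; last first.
    have := mem_nth 0 (_ : i < size (fset_set S))%N.
    by rewrite sizeS in_fset_set // inE => /(_ (ltn_ord i)).
  have /(nthP 0)[k] : x \in fset_set S by rewrite in_fset_set // inE.
  by rewrite sizeS => kn <-; exists (Ordinal kn).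
subst S.
have rank_triple i j k : i != j -> i != k -> j != k ->
    \rank ((q j - q i)%R + (q k - q i)%R)%MS = 2.
  move=> ij ik jk; have neq l m : l != m -> q l <> q m.
    by move=> lm /q_inj; apply/eqP.
  apply: rank_noncollinear (neq _ _ ij) _.
  by apply: no3collinear (neq _ _ ij) (neq _ _ ik) (neq _ _ jk);
    [exists i | exists j | exists k].
have nonflat i (U : 'M_3) : \rank U = 2 -> exists k, ~~ (q k - q i <= U)%MS.
  move=> rU; apply: contrapT => /forallNP h; apply: not_coplanar.
  exists [set x | (x - q i <= U)%MS]; split; first by exists (q i), U.
  by move=> _ [k _ <-] /=; apply/negPn/negP/h.
by rewrite (sum_plane_count rank_triple q_inj) sum_plane_traces.
Qed.
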